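(* Let $\alpha(n)$ be any function with $\alpha(n)\to\infty$ as $n\to\infty$, and let $p=p(n)$ satisfy $p\ge \frac{\log n+\alpha(n)}{n}$. Then with high probability (i.e. with probability tending to $1$ as $n\to\infty$) the random graph $G(n,p)$ satisfies $cfc(G(n,p))\le 2$.
   Context: $G(n,p)$ is the Erdős–Rényi random graph on $n$ labeled vertices in which each of the $\binom{n}{2}$ pairs is an edge independently with probability $p$. For a connected graph $G$ with an edge-coloring (adjacent edges may share colors), a path is conflict-free if some color appears on exactly one of its edges; the coloring is a conflict-free connection coloring if every two distinct vertices are joined by a conflict-free path. The conflict-free connection number $cfc(G)$ is the minimum number of colors in such a coloring. $\log$ denotes the natural logarithm. *)

(* Defs.v *)
From HB Require Import structures.
From mathcomp Require Import all_boot all_order all_algebra.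
From mathcomp Require Import all_classical all_reals all_analysis.

Set Implicit Arguments.
Unset Strict Implicit.
Unset Printing Implicit Defensive.

Import Order.TTheory GRing.Theory Num.Theory.
Import numFieldNormedType.Exports.

Local Open Scope classical_set_scope.
Local Open Scope ring_scope.

(* A simple graph on V is represented by its edge set E, a set of two-element *)
(* subsets of V, i.e. E \subset vpairs V.                                     *)
Definition vpairs (V : finType) : {set {set V}} := [set e : {set V} | #|e| == 2].

Definition adj (V : finType) (E : {set {set V}}) : rel V :=
  fun x y => [set x; y]%SET \in E.

Definition connected_graph (V : finType) (E : {set {set V}}) : Prop :=
  forall u v : V, connect (adj E) u v.

(* The path with vertex sequence u :: s; no vertex is repeated. *)
Definition graph_path (V : finType) (E : {set {set V}}) (u v : V) (s : seq V) :
    bool :=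
  [&& path (adj E) u s, uniq (u :: s) & last u s == v].

Definition path_edges (V : finType) (u : V) (s : seq V) : seq {set V} :=
  pairmap (fun x y => [set x; y]%SET) u s.

Definition conflict_free (V : finType) (c : {set V} -> nat) (u : V)
    (s : seq V) : Prop :=
  exists a : nat, count_mem a [seq c e | e <- path_edges u s] = 1%N.

(* Colours are natural numbers; only the values of c on E matter. *)
Definition cf_connection_coloring (V : finType) (E : {set {set V}})
    (c : {set V} -> nat) : Prop :=
  forall u v : V, u <> v ->
    exists2 s : seq V, graph_path E u v s & conflict_free c u s.

Definition cf_colorable (V : finType) (E : {set {set V}}) (k : nat) : Prop :=
  exists2 c : {set V} -> nat,
    {in E, forall e, (c e < k)%N} & cf_connection_coloring E c.

(* Giving distinct colours to distinct edges makes every nonempty path of a   *)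
(* connected graph conflict-free, so the minimum defining cfc exists.         *)
Lemma cf_colorable_ex (V : finType) (E : {set {set V}}) :
  connected_graph E -> exists k, `[< cf_colorable E k >].
Proof.
move=> Econn; exists #|{: {set V}}|; apply/asboolP.
exists (fun e => enum_rank e : nat) => [e _|u v uv]; first exact: ltn_ord.
have /connectP[s0 s0P vE] := Econn u v.
have : last u s0 = v by [].
case/shortenP: s0P => s sP us _ sv.
exists s; first by rewrite /graph_path sP us sv eqxx.
case: s sP us sv => [|x s] /= _ => [_ /uv//|/andP[us _] _].
exists (enum_rank [set u; x]%SET : nat); rewrite /= eqxx; congr S.
apply/eqP; rewrite -leqn0 leqNgt -has_count; apply/negP => /hasP[_ /mapP[e es ->]].
rewrite /= => /eqP/val_inj/enum_rank_inj eE; have {eE} : u \in e.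
  by rewrite eE !inE eqxx.
apply/negP; move: us; elim: s x es => //= y s IH x.
rewrite inE => /orP[/eqP ->|es].
  by rewrite !inE => /norP[/negPf-> /norP[/negPf->]].
by rewrite inE => /norP[_]; exact: IH.
Qed.

Definition cfc (V : finType) (E : {set {set V}}) (Econn : connected_graph E) :
    nat :=
  ex_minn (cf_colorable_ex Econn).

(* cfc is only defined for connected graphs: cfc(G) <= k includes the         *)
(* assertion that G is connected.                                             *)
Definition cfc_le (V : finType) (k : nat) (E : {set {set V}}) : Prop :=
  exists Econn : connected_graph E, (cfc Econn <= k)%N.

(* Law of G(n, p): a product over all pairs of Bernoulli(p) weights. *)
Definition gnp_weight (R : realType) (n : nat) (p : R)
    (E : {set {set 'I_n}}) : R :=
  \prod_(e in vpairs 'I_n) (if e \in E then p else 1 - p).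

Definition gnp_prob (R : realType) (n : nat) (p : R)
    (A : {set {set 'I_n}} -> Prop) : R :=
  \sum_(E : {set {set 'I_n}} | (E \subset vpairs 'I_n) && `[< A E >])
    gnp_weight p E.

(* Main.v *)
(** Call a vertex small if its degree is at most K.  For K about (log n) / 16,
    first-moment bounds show that with high probability no vertex is
    isolated, no two small vertices are adjacent or share a neighbour, and no set
    S with K <= |S| <= n / 2 has all its outside neighbours in a single vertex.
    In such a graph the vertices of degree at least 2 induce a graph H that stays
    connected after deleting any vertex, and the remaining vertices hang on
    distinct vertices of H.  Give colour 1 to one edge xy of H and colour 0 to all
    others: by Menger's theorem for two disjoint paths from {u, v} to {x, y}, any
    two vertices of H are joined by a path through xy, the pendant edges extend
    these paths, and a pendant vertex is adjacent to the vertex it hangs on. *)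
Require Import Defs.
From HB Require Import structures.
From mathcomp Require Import all_boot all_order all_algebra.
From mathcomp Require Import all_classical all_reals all_analysis.
From mathcomp Require Import zify ring lra.

Set Implicit Arguments.
Unset Strict Implicit.
Unset Printing Implicit Defensive.

Import Order.TTheory GRing.Theory Num.Theory.
Import numFieldNormedType.Exports.

Local Open Scope classical_set_scope.
Local Open Scope ring_scope.

(** * Two disjoint paths *)

Definition induced_rel (T : finType) (e : rel T) (A : {set T}) : rel T :=
  fun a b => [&& a \in A, b \in A & e a b].

(** [connect] relates every point to itself, so membership of [a] in [A] is required separately;
    membership of [b] then follows. *)
Definition linked (T : finType) (e : rel T) (A : {set T}) (a b : T) : bool :=
  (a \in A) && connect (induced_rel e A) a b.

Lemma linked_refl (T : finType) (e : rel T) (A : {set T}) a :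
  a \in A -> linked e A a a.
Proof. by move=> aA; rewrite /linked aA connect0. Qed.

Lemma linked_in (T : finType) (e : rel T) (A : {set T}) a b :
  linked e A a b -> (a \in A) && (b \in A).
Proof.
move=> /andP[aA /connectP[s]]; rewrite aA /=.
elim: s a aA => [|c s IH] a aA /=; first by move=> _ ->.
by move=> /andP[/and3P[_ cA _] sP]; exact: IH.
Qed.

Lemma linked_trans (T : finType) (e : rel T) (A : {set T}) a b c :
  linked e A a b -> linked e A b c -> linked e A a c.
Proof.
by move=> /andP[aA ab] /andP[_ bc]; rewrite /linked aA (connect_trans ab bc).
Qed.

Lemma linked_edge (T : finType) (e : rel T) (A : {set T}) a b :
  a \in A -> b \in A -> e a b -> linked e A a b.
Proof.
by move=> aA bA ab; rewrite /linked aA connect1 // /induced_rel aA bA ab.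
Qed.

Lemma linked_sym (T : finType) (e : rel T) (A : {set T}) :
  symmetric e -> symmetric (linked e A).
Proof.
move=> esym.
have wsym : connect_sym (induced_rel e A).
  apply: sym_connect_sym => a b.
  by rewrite /induced_rel esym andbCA.
suff H a b : linked e A a b -> linked e A b a by move=> a b; apply/idP/idP => /H.
move=> ab; have /andP[_ bA] := linked_in ab.
by case/andP: ab => _ ab; rewrite /linked bA wsym.
Qed.

Lemma linked_mono (T : finType) (e : rel T) (A B : {set T}) a b :
  A \subset B -> linked e A a b -> linked e B a b.
Proof.
move=> /fintype.subsetP AB /andP[aA ab]; rewrite /linked (AB _ aA) /=.
apply: connect_sub ab => c d /and3P[cA dA cd].
by rewrite connect1 // /induced_rel !AB.
Qed.

(** Walk from [a] to [b] and stop at the first step on which [P] fails. This is how connectivity is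
    used below: a property that passes along edges spreads to the whole set. *)
Lemma linked_exit (T : finType) (e : rel T) (A : {set T}) (P : pred T) a b :
  linked e A a b -> P a -> ~~ P b ->
  exists c d, [/\ c \in A, d \in A, e c d, P c & ~~ P d].
Proof.
move=> /andP[_ /connectP[s]]; elim: s a => [|c s IH] a /=.
  by move=> _ -> ->.
move=> /andP[/and3P[aA cA ac] sP] bE Pa Pb.
have [Pc|Pc] := boolP (P c); first exact: (IH c).
by exists a, c.
Qed.

Lemma linked_path (T : finType) (e : rel T) (A : {set T}) a b :
  linked e A a b -> exists2 s, path e a s &
    [/\ uniq (a :: s), last a s = b & {subset a :: s <= A}].
Proof.
move=> /andP[aA /connectP[s0 s0P ->]]; case/shortenP: s0P => s sP us _.
exists s; first by apply: sub_path sP => c d /and3P[].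
split=> //; elim: s a aA sP {us} => [|c s IH] a aA /=.
  by move=> _ d; rewrite inE => /eqP ->.
move=> /andP[/and3P[_ cA _] sP] d; rewrite inE => /orP[/eqP -> //|].
exact: IH.
Qed.

(** Every vertex of a walk from [a] to [b] is itself linked to [b]. This shrinks a connecting set to
    a component, which is easier to keep disjoint from other sets. *)
Lemma linked_component (T : finType) (e : rel T) (A : {set T}) a b :
  symmetric e -> linked e A a b ->
  linked e [set c | linked e A c b]%SET a b.
Proof.
move=> esym ab; set C := [set c | _]%SET; have lsym := linked_sym _ esym.
have /andP[_ bA] := linked_in ab.
have bC : b \in C by rewrite inE linked_refl.
apply: contraT => nab.
have [|||c [d [cA dA cd cb]]] := @linked_exit _ e A (fun z => linked e C z b) b a.
- by rewrite lsym.
- exact: linked_refl.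
- exact: nab.
have /andP[cC _] := linked_in cb.
have dC : d \in C.
  rewrite inE; apply: (@linked_trans _ _ _ _ c); last by rewrite inE in cC.
  by apply: linked_edge => //; rewrite esym.
by case/negP; apply: linked_trans cb; apply: linked_edge => //; rewrite esym.
Qed.

(** Two disjoint paths are encoded by disjoint sets containing them, so that rerouting needs no
    surgery on sequences. The pairing of ends is left open because augmentation may swap it. *)
Definition disjointly_linked (T : finType) (e : rel T) (H : {set T})
    (x y u v : T) : Prop :=
  exists A B : {set T},
    [/\ A \subset H, B \subset H, {in A, forall z, z \notin B} &
        (linked e A u x && linked e B v y) || (linked e A u y && linked e B v x)].

Lemma disjointly_linkedC (T : finType) (e : rel T) (H : {set T}) x y u v :
  disjointly_linked e H x y u v -> disjointly_linked e H y x u v.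
Proof. by move=> [A [B [AH BH AB h]]]; exists A, B; rewrite orbC. Qed.

(* If the path [B] runs through [u], let [D] be the part of [B] beyond [u] and
   let [R] be what [v] reaches off [A], [D] and [u].  Since [H - u] is connected,
   [R] touches [A] or [D], which reroutes the path from [v] around [u]. *)
Lemma disjointly_linked_augment (T : finType) (e : rel T) (H A B : {set T})
    (x y u u1 v : T) :
  symmetric e ->
  (forall w a b, a \in H :\ w -> b \in H :\ w -> linked e (H :\ w) a b) ->
  A \subset H -> B \subset H -> {in A, forall z, z \notin B} ->
  linked e A u1 x -> linked e B v y ->
  u \in H -> e u u1 -> u <> v ->
  disjointly_linked e H x y u v.
Proof.
move=> esym Hconn AH BH AB u1x vy uH uu1 /eqP uv.
have /andP[u1A xA] := linked_in u1x.
have /andP[vB yB] := linked_in vy.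
have lsym := linked_sym _ esym.
have AHs := fintype.subsetP AH; have BHs := fintype.subsetP BH.
have extend (A1 : {set T}) : u1 \in A1 -> linked e A1 u1 x -> linked e (u |: A1) u x.
  move=> u1A1 h; apply: (@linked_trans _ _ _ _ u1).
    by apply: linked_edge => //; rewrite !inE ?eqxx ?u1A1 ?orbT.
  by apply: linked_mono h; exact: finset.subsetUr.
have [uB|uB] := boolP (u \in B); last first.
  exists (u |: A), B; split => //.
  - by rewrite finset.subUset finset.sub1set uH.
  - by move=> z; rewrite finset.in_setU1 => /orP[/eqP ->//|/AB].
  by rewrite vy extend.
have [vy'|vy'] := boolP (linked e (B :\ u) v y).
  exists (u |: A), (B :\ u); split => //.
  - by rewrite finset.subUset finset.sub1set uH.
  - by apply/fintype.subsetP => z; rewrite finset.in_setD1 => /andP[_ /BHs].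
  - move=> z; rewrite finset.in_setU1 finset.in_setD1 negb_and negbK.
    by move=> /orP[->//|/AB ->]; rewrite orbT.
  by rewrite vy' extend.
pose D := [set d | linked e (B :\ u) d y]%SET.
pose A0 := [set a | linked e A a x]%SET.
pose W := H :\ u :\: (A0 :|: D).
pose Rr := [set r | linked e W r v]%SET.
have A0A z : z \in A0 -> z \in A by rewrite inE => /linked_in/andP[].
have DB z : z \in D -> z \in B :\ u by rewrite inE => /linked_in/andP[].
have uA : u \notin A by apply: contraL uB; exact: AB.
have vW : v \in W.
  rewrite finset.in_setD finset.in_setU finset.in_setD1 eq_sym uv BHs // !andbT negb_or.
  apply/andP; split; last by rewrite inE.
  by apply: contraL vB => /A0A; exact: AB.
have RW z : z \in Rr -> z \in W by rewrite inE => /linked_in/andP[].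
have RN z : z \in Rr -> [/\ z \in H, z != u, z \notin A0 & z \notin D].
  move=> /RW; rewrite finset.in_setD finset.in_setU finset.in_setD1 negb_or -!andbA.
  by move=> /and4P[].
have A0x : u1 \in A0 by rewrite inE.
have xA0 : x \in A0 by rewrite inE linked_refl.
(* Inside [B], the set [D] can be entered only from [u]: any other neighbour of [D] in [B] already
   belongs to [D]. *)
have uDy : linked e (u |: D) u y.
  have [<-|uy] := eqVneq u y; first by rewrite linked_refl // !inE eqxx.
  have yD : y \in D by rewrite inE linked_refl // !inE eq_sym uy.
  have [|||r [z [rB zB rz rD]]] := @linked_exit _ e B (fun b => b \notin D) v y.
  - exact: vy.
  - by rewrite inE.
  - by rewrite negbK.
  rewrite negbK => zD.
  have ru : r = u.
    apply/eqP; apply: contraNT rD => ru; rewrite inE.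
    apply: (@linked_trans _ _ _ _ z); last by rewrite inE in zD.
    by apply: linked_edge; [rewrite finset.in_setD1 ru|exact: DB|].
  subst r; apply: (@linked_trans _ _ _ _ z).
    by apply: linked_edge => //; rewrite finset.in_setU1 ?eqxx ?zD ?orbT.
  apply: (@linked_mono _ _ D); first exact: finset.subsetUr.
  by apply: linked_component => //; rewrite inE in zD.
have [|||r [z [rH zH rz rR zR]]] :=
    @linked_exit _ e (H :\ u) (fun b => b \in Rr) v x.
- apply: Hconn; rewrite finset.in_setD1; first by rewrite eq_sym uv BHs.
  by rewrite AHs // andbT; apply: contraNneq uA => <-.
- by rewrite inE linked_refl.
- by apply/negP => /RN[_ _]; rewrite xA0.
have zAD : z \in A0 :|: D.
  apply: contraNT zR => zAD; rewrite inE.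
  apply: (@linked_trans _ _ _ _ r); last by rewrite inE in rR.
  by apply: linked_edge; [rewrite finset.in_setD zAD|exact: RW|rewrite esym].
have vr (C : {set T}) t : z \in C -> linked e C z t -> linked e (Rr :|: C) v t.
  move=> zC zt; apply: (@linked_trans _ _ _ _ z); last first.
    by apply: linked_mono zt; exact: finset.subsetUr.
  apply: (@linked_trans _ _ _ _ r); last first.
    by apply: linked_edge; rewrite // finset.in_setU ?rR ?zC ?orbT.
  apply: (@linked_mono _ _ Rr); first exact: finset.subsetUl.
  by rewrite lsym; apply: linked_component => //; rewrite inE in rR.
have RH : Rr \subset H by apply/fintype.subsetP => t /RN[].
have A0H : A0 \subset H by apply/fintype.subsetP => t /A0A /AHs.
have DH : D \subset H.
  by apply/fintype.subsetP => t /DB; rewrite finset.in_setD1 => /andP[_ /BHs].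
have A0D t : t \in A0 -> t \notin D.
  by move=> /A0A/AB; apply: contra => /DB; rewrite finset.in_setD1 => /andP[].
have uR : u \notin Rr by apply/negP => /RN[_]; rewrite eqxx.
(* If [Rr] touches [A0], then [v] takes over the route to [x] and [u] follows [D] to [y]; if it
   touches [D], then [v] rejoins [D] towards [y] and [u] goes through [u1] to [x]. *)
case/setUP: zAD => [zA|zD].
- exists (u |: D), (Rr :|: A0); split.
  + by rewrite finset.subUset finset.sub1set uH.
  + by rewrite finset.subUset RH.
  + move=> t; rewrite finset.in_setU1 finset.in_setU negb_or => /orP[/eqP ->|tD].
      by rewrite uR /=; apply: contra uA; exact: A0A.
    apply/andP; split; first by apply/negP => /RN[_ _ _]; rewrite tD.
    by apply: contraL tD; exact: A0D.
  rewrite uDy orbC vr //; apply: linked_component => //.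
  by rewrite inE in zA.
exists (u |: A0), (Rr :|: D); split.
- by rewrite finset.subUset finset.sub1set uH.
- by rewrite finset.subUset RH.
- move=> t; rewrite finset.in_setU1 finset.in_setU negb_or => /orP[/eqP ->|tA].
    by rewrite uR /=; apply/negP => /DB; rewrite finset.in_setD1 eqxx.
  by rewrite A0D // andbT; apply/negP => /RN[_ _]; rewrite tA.
rewrite extend //=; last by apply: linked_component.
by rewrite vr //; apply: linked_component => //; rewrite inE in zD.
Qed.

(** This is Menger's theorem for two paths. For fixed [v] other than [x], the vertices [u] that
    satisfy the claim include [x] and, by augmentation, are closed under adjacency in the connected
    set [H :\ v]. For [v = x] the sets [H :\ x] and [{x}] serve. *)
Lemma disjointly_linked_all (T : finType) (e : rel T) (H : {set T})
    (x y u v : T) :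
  symmetric e ->
  (forall w a b, a \in H :\ w -> b \in H :\ w -> linked e (H :\ w) a b) ->
  x \in H -> y \in H -> x <> y -> u \in H -> v \in H -> u <> v ->
  disjointly_linked e H x y u v.
Proof.
move=> esym Hconn xH yH /eqP xy uH vH /eqP uv.
have lsym := linked_sym _ esym.
have end_case z t : z \in H -> t \in H -> t != x -> z != x ->
    linked e (H :\ x) z t.
  by move=> zH tH tx zx; apply: Hconn; rewrite finset.in_setD1 ?tx ?zx.
have sub1 : [set x]%SET \subset H by rewrite finset.sub1set.
have sub2 : H :\ x \subset H by exact: finset.subsetDl.
have lxx : linked e [set x]%SET x x by rewrite linked_refl ?inE.
have [vx|vx] := eqVneq v x.
  exists (H :\ x), [set x]%SET; split => //.
    by move=> z; rewrite finset.in_setD1 finset.in_set1 => /andP[].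
  have ux : u != x by rewrite -vx.
  by rewrite vx lxx (end_case u y) ?orbT // eq_sym.
apply/asboolP; apply: contraT => /asboolPn nuv.
have [|||c [d [cA dA cd]]] := @linked_exit _ e (H :\ v)
    (fun z => `[< disjointly_linked e H x y z v >]) x u.
- by apply: Hconn; rewrite finset.in_setD1 ?uv // eq_sym vx.
- apply/asboolP; exists [set x]%SET, (H :\ x); split => //.
    by move=> z; rewrite finset.in_setD1 finset.in_set1 => /eqP ->; rewrite eqxx.
  by rewrite lxx end_case // eq_sym.
- exact/asboolPn.
move=> /asboolP[A [B [AH BH AB cv]]] /asboolPn; case.
move: dA; rewrite finset.in_setD1 => /andP[/eqP dv dH].
have dc : e d c by rewrite esym.
case/orP: cv => /andP[cx vy].
  exact: (disjointly_linked_augment esym Hconn AH BH AB cx vy dH dc dv).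
apply: disjointly_linkedC.
exact: (disjointly_linked_augment esym Hconn AH BH AB cx vy dH dc dv).
Qed.

(** * Colouring *)

Lemma adjC (V : finType) (E : {set {set V}}) : symmetric (adj E).
Proof. by move=> a b; rewrite /adj finset.setUC. Qed.

Lemma adj_neq (V : finType) (E : {set {set V}}) a b :
  E \subset vpairs V -> adj E a b -> a != b.
Proof.
move=> /fintype.subsetP EV /EV; rewrite inE cards2.
by case: (a == b).
Qed.

Lemma path_edges_sub (V : finType) (u z : V) (s : seq V) (e : {set V}) :
  e \in path_edges u s -> z \in e -> z \in u :: s.
Proof.
elim: s u => //= a s IH u; rewrite inE => /orP[/eqP ->|/IH h /h].
  by rewrite !inE => /orP[->|->]; rewrite ?orbT.
by move=> zs; rewrite inE zs orbT.
Qed.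

Definition marked_edge (V : finType) (x y : V) (e : {set V}) : nat :=
  e == [set x; y]%SET.

Lemma count_marked_edge0 (V : finType) (x y z u : V) (s : seq V) :
  z \in [set x; y]%SET -> z \notin u :: s ->
  count_mem 1%N [seq marked_edge x y e | e <- path_edges u s] = 0%N.
Proof.
move=> zxy zs; rewrite count_map; apply/eqP; rewrite -leqn0 leqNgt -has_count.
apply/hasPn => e es /=; rewrite /marked_edge eqb1; apply/eqP => eE.
by case/negP: zs; apply: (path_edges_sub es); rewrite eE.
Qed.

(** Colour 1 occurs once: since no vertex repeats, the part before the crossing avoids [y] and the
    part after it avoids [x], so neither contains the marked edge. *)
Lemma conflict_free_through (V : finType) (x y u : V) (s1 s2 : seq V) :
  last u s1 = x -> uniq (u :: s1 ++ y :: s2) ->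
  conflict_free (marked_edge x y) u (s1 ++ y :: s2).
Proof.
move=> l1; rewrite -cat_cons cat_uniq => /and3P[us1 /hasPn dis us2].
exists 1%N; rewrite {1}/path_edges pairmap_cat map_cat count_cat /= l1.
rewrite {2}/marked_edge eqxx /=.
rewrite (@count_marked_edge0 _ x y y u s1) ?inE ?eqxx ?orbT //; last first.
  by have := dis y; rewrite inE eqxx => /(_ isT).
rewrite (@count_marked_edge0 _ x y x y s2) ?inE ?eqxx //.
by apply/negP => /dis; rewrite /= -l1 mem_last.
Qed.

(* [H] is the 2-connected core; the other vertices hang on distinct vertices of [H]. *)
Lemma hanging_conflict_free_path (V : finType) (E : {set {set V}}) (H : {set V})
    (x y : V) :
  E \subset vpairs V ->
  (forall w a b, a \in H :\ w -> b \in H :\ w -> linked (adj E) (H :\ w) a b) ->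
  x \in H -> y \in H -> adj E x y ->
  (forall u, u \notin H -> exists2 u', u' \in H & adj E u u') ->
  (forall u v w, u \notin H -> v \notin H -> adj E u w -> adj E v w -> u = v) ->
  cf_connection_coloring E (marked_edge x y).
Proof.
move=> EV Hconn xH yH xy hang hang_inj.
have esym := @adjC _ E.
(* The marked edge may be crossed in either direction, so [x'] and [y'] name its ends in order of
   traversal. Staying inside [H] lets pendant ends be attached later without repeating a vertex. *)
have base u v : u \in H -> v \in H -> u <> v -> exists x' y' s1 s2,
    [/\ ([set x'; y'] = [set x; y])%SET,
        [/\ path (adj E) u s1, path (adj E) y' s2, last u s1 = x' & last y' s2 = v],
        uniq (u :: s1 ++ y' :: s2) & {subset u :: s1 ++ y' :: s2 <= H}].
  move=> uH vH uv.
  have [A [B [/fintype.subsetP AH /fintype.subsetP BH AB]]] :=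
    disjointly_linked_all esym Hconn xH yH (elimN eqP (adj_neq EV xy)) uH vH uv.
  have key x' y' : linked (adj E) A u x' -> linked (adj E) B v y' -> exists s1 s2,
    [/\ path (adj E) u s1, path (adj E) y' s2, last u s1 = x' & last y' s2 = v] /\
    (uniq (u :: s1 ++ y' :: s2) /\ {subset u :: s1 ++ y' :: s2 <= H}).
    move=> /linked_path[s1 p1 [u1 l1 A1]].
    rewrite linked_sym // => /linked_path[s2 p2 [u2 l2 B2]].
    exists s1, s2; split=> //; rewrite -cat_cons; split.
      rewrite cat_uniq u1 u2 andbT; apply/hasPn => z /B2 zB.
      by apply: contraL zB => /A1; exact: AB.
    by move=> z; rewrite mem_cat => /orP[/A1/AH|/B2/BH].
  case/orP => /andP[h1 h2].
    by have [s1 [s2 [? [? ?]]]] := key _ _ h1 h2; exists x, y, s1, s2.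
  have [s1 [s2 [? [? ?]]]] := key _ _ h1 h2; exists y, x, s1, s2.
  by rewrite finset.setUC.
have thru x' y' u v s1 s2 : ([set x'; y'] = [set x; y])%SET ->
    path (adj E) u s1 -> path (adj E) y' s2 -> last u s1 = x' ->
    last y' s2 = v -> uniq (u :: s1 ++ y' :: s2) ->
    exists2 s, graph_path E u v s & conflict_free (marked_edge x y) u s.
  move=> xy' p1 p2 l1 l2 us; exists (s1 ++ y' :: s2); last first.
    by rewrite /marked_edge -xy'; exact: conflict_free_through.
  rewrite /graph_path us cat_path p1 /= l1 last_cat /= l2 eqxx p2 !andbT.
  by rewrite /adj xy'.
(* A path of one edge is conflict-free under any colouring; it serves a pendant vertex and the
   vertex it hangs on. *)
have single u v : adj E u v ->
    exists2 s, graph_path E u v s & conflict_free (marked_edge x y) u s.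
  move=> uv; exists [:: v].
    by rewrite /graph_path /= uv eqxx inE (adj_neq EV uv).
  by exists (marked_edge x y [set u; v]%SET); rewrite /= eqxx.
move=> u v uv.
have [uH|uH] := boolP (u \in H); have [vH|vH] := boolP (v \in H).
- have [x' [y' [s1 [s2 [? [? ? ? ?] ? _]]]]] := base u v uH vH uv.
  exact: (thru x' y' _ _ s1 s2).
- have [v' v'H vv'] := hang v vH.
  have [uv'|/eqP uv'] := eqVneq u v'; first by apply: single; rewrite uv' esym.
  have [x' [y' [s1 [s2 [exy [p1 p2 l1 l2] us sH]]]]] := base u v' uH v'H uv'.
  apply: (thru x' y' _ _ s1 (rcons s2 v)) => //.
  + by rewrite rcons_path p2 l2 esym.
  + by rewrite last_rcons.
  rewrite -rcons_cons -rcons_cat -rcons_cons rcons_uniq us andbT.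
  by apply: contra vH; exact: sH.
- have [u' u'H uu'] := hang u uH.
  have [uv'|/eqP uv'] := eqVneq u' v; first by apply: single; rewrite -uv'.
  have [x' [y' [s1 [s2 [exy [p1 p2 l1 l2] us sH]]]]] := base u' v u'H vH uv'.
  apply: (thru x' y' _ _ (u' :: s1) s2) => //; first by rewrite /= uu'.
  rewrite cat_cons cons_uniq us andbT.
  by apply: contra uH; exact: sH.
have [u' u'H uu'] := hang u uH; have [v' v'H vv'] := hang v vH.
have [uv'|/eqP uv'] := eqVneq u' v'.
  by case: uv; apply: (hang_inj u v u') => //; rewrite uv'.
have [x' [y' [s1 [s2 [exy [p1 p2 l1 l2] us sH]]]]] := base u' v' u'H v'H uv'.
apply: (thru x' y' _ _ (u' :: s1) (rcons s2 v)) => //.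
- by rewrite /= uu'.
- by rewrite rcons_path p2 l2 esym.
- by rewrite last_rcons.
rewrite -rcons_cons -rcons_cat -rcons_cons rcons_uniq.
rewrite inE negb_or cons_uniq us andbT.
apply/andP; split; last by apply: contra uH; exact: sH.
by apply/andP; split; [apply/eqP => vu; case: uv|apply: contra vH; exact: sH].
Qed.

(** * Expansion and connectivity of the core *)

Definition nbrs (V : finType) (E : {set {set V}}) (v : V) : {set V} :=
  [set u | adj E v u]%SET.

(** The deterministic properties required of the random graph. The exempted vertex [w] makes
    expansion survive the deletion of any one vertex. *)
Definition spread (V : finType) (E : {set {set V}}) (K : nat) : Prop :=
  [/\ forall v, exists u, adj E v u,
      forall a b, a != b -> (#|nbrs E a| <= K)%N -> (#|nbrs E b| <= K)%N ->
        ~~ adj E a b /\ forall c, ~~ (adj E a c && adj E b c)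
    & forall w (S : {set V}), w \notin S -> (K <= #|S|)%N -> (2 * #|S| <= #|V|)%N ->
        exists a b, [/\ a \in S, b \notin S, b != w & adj E a b]].

(** Let [S z] be the component of [z] in [H :\ w] together with the pendant vertices attached to it.
    Edges leave [S z] only towards [w]. If [S z] had fewer than [K] vertices, all of them would be
    small, yet [z] has a neighbour there; so expansion forces [S z] to exceed half of [V]. Two
    different components would give two disjoint such sets. *)
Lemma spread_core_connected (V : finType) (E : {set {set V}}) (K : nat) :
  E \subset vpairs V -> spread E K ->
  let H := [set v | (1 < #|nbrs E v|)%N]%SET in
  forall w a b, a \in H :\ w -> b \in H :\ w -> linked (adj E) (H :\ w) a b.
Proof.
move=> EV [D1 D2 D3] H w u v uH vH; apply: contraT => nuv.
have esym := @adjC _ E.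
pose A z := [set a | linked (adj E) (H :\ w) a z]%SET.
pose S z := [set d | (d \in A z) ||
   [&& d \notin H, d != w & [exists a in A z, adj E d a]]]%SET.
have pend d a b : d \notin H -> adj E d a -> adj E d b -> a = b.
  rewrite inE -leqNgt => /card_le1_eqP h da db.
  by apply: h; rewrite inE.
have AH z a : a \in A z -> a \in H :\ w by rewrite inE => /linked_in/andP[].
have wS z : w \notin S z.
  by rewrite inE eqxx andbF orbF; apply/negP => /AH; rewrite !inE eqxx.
have Scl z s b : s \in S z -> adj E s b -> b != w -> b \in S z.
  rewrite inE => /orP[sA sb bw|/and3P[sH sw /existsP[a /andP[aA sa]]] sb bw].
    rewrite inE; have [bH|bH] := boolP (b \in H); apply/orP.
      left; rewrite inE; apply: (@linked_trans _ _ _ _ s); last by rewrite inE in sA.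
      by apply: linked_edge; [rewrite finset.in_setD1 bw|exact: AH sA|rewrite esym].
    by right; rewrite bw; apply/existsP; exists s; rewrite sA esym.
  by rewrite (pend _ _ _ sH sb sa) inE aA.
have Sbig z : z \in H :\ w -> (K <= #|S z|)%N.
  move=> zHw; rewrite leqNgt; apply/negP => Sk.
  have zS : z \in S z by rewrite !inE linked_refl.
  have degS s : s \in S z -> (#|nbrs E s| <= K)%N.
    move=> sS; apply: leq_trans (ltnW Sk).
    (* Allowing for [w] costs one neighbour and excluding [s] itself gains it back, so the degree is
       at most [#|S z|]. *)
    have : nbrs E s \subset w |: (S z :\ s).
      apply/fintype.subsetP => b; rewrite inE finset.in_setU1 finset.in_setD1 => sb.
      have [//|bw] := eqVneq b w; rewrite (Scl z s) //.
      by rewrite eq_sym (adj_neq EV sb).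
    move=> /subset_leq_card h; apply: leq_trans h _.
    by rewrite cardsU1 (cardsD1 s (S z)) sS leq_add2r leq_b1.
  have [z' zz' z'w] : exists2 z', adj E z z' & z' != w.
    move: zHw; rewrite !inE => /andP[_ /card_gt1P[a [b [az bz ab]]]].
    rewrite !inE in az bz; have [aw|aw] := eqVneq a w; last by exists a.
    by exists b => //; rewrite -aw eq_sym.
  have z'S := Scl z z z' zS zz' z'w.
  by have [] := D2 z z' (adj_neq EV zz') (degS _ zS) (degS _ z'S); rewrite zz'.
have Shalf z : z \in H :\ w -> (#|V| < 2 * #|S z|)%N.
  move=> zH; rewrite ltnNge; apply/negP => h.
  have [a [b [aS bS bw ab]]] := D3 w (S z) (wS z) (Sbig z zH) h.
  by rewrite (Scl z a b) in bS.
have Sdis : S u :&: S v = finset.set0.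
  have Adis a : a \in A u -> a \in A v -> False.
    rewrite !inE => au av; case/negP: nuv.
    by apply: linked_trans av; rewrite linked_sym.
  apply/setP => d; rewrite finset.in_setI finset.in_set0.
  apply/negP => /andP[]; rewrite [d \in S u]inE [d \in S v]inE.
  move=> /orP[du|/and3P[dH _ /existsP[a /andP[aA da]]]].
    move=> /orP[dv|/and3P[dH _ _]]; first exact: (Adis d).
    by move: (AH _ _ du); rewrite finset.in_setD1 (negbTE dH) andbF.
  move=> /orP[dv|/and3P[_ _ /existsP[b /andP[bA db]]]].
    by move: (AH _ _ dv); rewrite finset.in_setD1 (negbTE dH) andbF.
  by apply: (Adis a) => //; rewrite (pend d a b).
have := leq_add (Shalf u uH) (Shalf v vH).
have := max_card (S u :|: S v); rewrite cardsU Sdis cards0.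
by move=> *; lia.
Qed.

(** Since [K] is positive, vertices of degree at most 1 are small; hence they are attached to [H],
    at distinct vertices. *)
Lemma cf_colorable2 (V : finType) (E : {set {set V}}) (K : nat) :
  (0 < #|V|)%N -> (0 < K)%N -> E \subset vpairs V -> spread E K -> cf_colorable E 2.
Proof.
move=> V0 K0 EV sp; have Hconn := spread_core_connected EV sp.
have [D1 D2 D3] := sp.
set H := [set v | (1 < #|nbrs E v|)%N]%SET in Hconn.
have esym := @adjC _ E.
have small u : u \notin H -> (#|nbrs E u| <= K)%N.
  by rewrite inE -leqNgt => h; apply: leq_trans K0.
have hang u : u \notin H -> exists2 u', u' \in H & adj E u u'.
  move=> uH; have [u' uu'] := D1 u; exists u' => //; apply: contraT => u'H.
  by have [] := D2 u u' (adj_neq EV uu') (small _ uH) (small _ u'H); rewrite uu'.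
have hang_inj u v w : u \notin H -> v \notin H -> adj E u w -> adj E v w -> u = v.
  move=> uH vH uw vw; apply/eqP; apply: contraT => uv.
  by have [_ /(_ w)] := D2 u v uv (small _ uH) (small _ vH); rewrite uw vw.
have [x xH] : exists x, x \in H.
  have /card_gt0P[v _] := V0.
  have [vH|vH] := boolP (v \in H); first by exists v.
  by have [x xH _] := hang v vH; exists x.
(* Of two neighbours of [x], at most one lies outside [H], as vertices outside [H] share no
   neighbour. *)
have [y yH xy] : exists2 y, y \in H & adj E x y.
  have /card_gt1P[a [b]] : (1 < #|nbrs E x|)%N by rewrite inE in xH.
  rewrite !inE => -[xa xb ab].
  have [aH|aH] := boolP (a \in H); first by exists a.
  have [bH|bH] := boolP (b \in H); first by exists b.
  by move: ab; rewrite (hang_inj a b x) ?eqxx // esym.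
exists (marked_edge x y); first by move=> e _; rewrite /marked_edge; case: (_ == _).
exact: (hanging_conflict_free_path EV Hconn).
Qed.

Lemma spread_cfc_le2 (V : finType) (E : {set {set V}}) (K : nat) :
  (0 < #|V|)%N -> (0 < K)%N -> E \subset vpairs V -> spread E K -> cfc_le 2 E.
Proof.
move=> V0 K0 EV sp; have cf2 := cf_colorable2 V0 K0 EV sp.
have Econn : connected_graph E.
  move=> u v; have [->|/eqP uv] := eqVneq u v; first exact: connect0.
  have [c _ /(_ u v uv)[s /and3P[sP _ /eqP sv] _]] := cf2.
  by apply/connectP; exists s.
exists Econn; rewrite /cfc; case: ex_minnP => m _; apply.
exact/asboolP.
Qed.

(** * First-moment bounds *)

Definition gnp_mean (R : realType) (n : nat) (p : R)
    (f : {set {set 'I_n}} -> R) : R :=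
  \sum_(E : {set {set 'I_n}} | E \subset vpairs 'I_n) gnp_weight p E * f E.

(** This is independence of the pairs: expanding the product by distributivity yields one term per
    edge set. *)
Lemma gnp_mean_prod (R : realType) (n : nat) (p : R) (g : {set 'I_n} -> bool -> R) :
  gnp_mean p (fun E => \prod_(e in vpairs 'I_n) g e (e \in E)) =
  \prod_(e in vpairs 'I_n) (p * g e true + (1 - p) * g e false).
Proof.
set P := vpairs 'I_n.
(* The values 0 and 1 off [P] allow expansion over all sets of vertices while killing every [E] not
   contained in [P]. *)
pose F e := if e \in P then p * g e true else 0.
pose G e := if e \in P then (1 - p) * g e false else 1.
transitivity (\prod_e (F e + G e)); last first.
  rewrite [RHS]big_mkcond; apply: eq_bigr => e _; rewrite /F /G.
  by case: ifP; rewrite ?add0r.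
rewrite bigA_distr /gnp_mean.
rewrite [RHS](bigID (fun E : {set {set 'I_n}} => E \subset P)) /=.
rewrite [X in _ = _ + X]big1 ?addr0 => [|E /subsetPn[e eE eP]]; last first.
  by rewrite (bigD1 e) //= eE /F (negbTE eP) mul0r.
apply: eq_bigr => E /fintype.subsetP EP; rewrite /gnp_weight -big_split /= big_mkcond.
apply: eq_bigr => e _; rewrite /F /G.
have [eE|eE] := boolP (e \in E); first by rewrite (EP _ eE).
by case: ifP.
Qed.

(** By independence this is the probability that [F] is present times the generating function of a
    binomial edge count on [T]. At [t = 0] the latter becomes the probability that [T] has no
    edge. *)
Lemma gnp_mean_tilt (R : realType) (n : nat) (p t : R) (F T : {set {set 'I_n}}) :
  F \subset vpairs 'I_n -> T \subset vpairs 'I_n -> {in F, forall e, e \notin T} ->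
  gnp_mean p (fun E => (F \subset E)%:R * t ^+ #|T :&: E|) =
  p ^+ #|F| * (1 - p + p * t) ^+ #|T|.
Proof.
move=> /fintype.subsetP FP /fintype.subsetP TP FT; set P := vpairs 'I_n.
pose g (e : {set 'I_n}) (b : bool) : R :=
  (if e \in F then b%:R else 1) * (if e \in T then (if b then t else 1) else 1).
have prodF h : \prod_(e in P) (if e \in F then h e else 1) = \prod_(e in F) h e :> R.
  rewrite -big_mkcondr; apply: eq_bigl => e.
  by apply/andP/idP => [[]//|eF]; split=> //; exact: FP.
have prodT h : \prod_(e in P) (if e \in T then h e else 1) = \prod_(e in T) h e :> R.
  rewrite -big_mkcondr; apply: eq_bigl => e.
  by apply/andP/idP => [[]//|eF]; split=> //; exact: TP.
transitivity (gnp_mean p (fun E => \prod_(e in P) g e (e \in E))).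
  rewrite /gnp_mean; apply: eq_bigr => E _; congr (_ * _).
  rewrite /g big_split /= prodF prodT.
  congr (_ * _).
    have [/fintype.subsetP FE|/subsetPn[e eF eE]] := boolP (F \subset E).
      by rewrite big1 // => e /FE ->.
    by rewrite (bigD1 e) //= (negbTE eE) mul0r.
  rewrite -big_mkcondr prodr_const; congr (_ ^+ _).
  by apply: eq_card => e; rewrite !inE.
rewrite gnp_mean_prod -!prodr_const -prodF -prodT -big_split /=.
apply: eq_bigr => e _; rewrite /g.
have [eF|eF] := boolP (e \in F); first by rewrite (negbTE (FT _ eF)) /=; ring.
by case: ifP => _; ring.
Qed.

Lemma gnp_weight_ge0 (R : realType) (n : nat) (p : R) (E : {set {set 'I_n}}) :
  0 <= p <= 1 -> 0 <= gnp_weight p E.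
Proof.
by move=> /andP[p0 p1]; apply: prodr_ge0 => e _; case: ifP; rewrite ?subr_ge0.
Qed.

Lemma gnp_mean1 (R : realType) (n : nat) (p : R) : @gnp_mean R n p (fun=> 1) = 1.
Proof.
rewrite -[RHS](@big1_eq _ 1 *%R _ (index_enum _) (fun e => e \in vpairs 'I_n)).
transitivity (@gnp_mean R n p (fun E => \prod_(e in vpairs 'I_n) 1)).
  by rewrite /gnp_mean; apply: eq_bigr => E _; rewrite big1_eq.
by rewrite (gnp_mean_prod p (fun _ _ => 1)); apply: eq_bigr => e _; ring.
Qed.

Lemma gnp_meanD (R : realType) (n : nat) (p : R) (f g : {set {set 'I_n}} -> R) :
  gnp_mean p (fun E => f E + g E) = gnp_mean p f + gnp_mean p g.
Proof. by rewrite /gnp_mean -big_split; apply: eq_bigr => E _; rewrite mulrDr. Qed.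

Lemma gnp_meanZ (R : realType) (n : nat) (p a : R) (f : {set {set 'I_n}} -> R) :
  gnp_mean p (fun E => a * f E) = a * gnp_mean p f.
Proof. by rewrite /gnp_mean mulr_sumr; apply: eq_bigr => E _; rewrite mulrCA. Qed.

Lemma gnp_mean_sum (R : realType) (n : nat) (p : R) (I : finType) (P : pred I)
    (f : I -> {set {set 'I_n}} -> R) :
  gnp_mean p (fun E => \sum_(i | P i) f i E) = \sum_(i | P i) gnp_mean p (f i).
Proof.
rewrite /gnp_mean exchange_big; apply: eq_bigr => E _; exact: mulr_sumr.
Qed.

Lemma gnp_prob_le1 (R : realType) (n : nat) (p : R) (A : {set {set 'I_n}} -> Prop) :
  0 <= p <= 1 -> gnp_prob p A <= 1.
Proof.
move=> p01; rewrite -[leRHS](@gnp_mean1 R n p) /gnp_prob big_mkcondr /=.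
apply: ler_sum => E _; rewrite mulr1; case: ifP => // _.
exact: gnp_weight_ge0.
Qed.

(** Markov's inequality: [f] dominates the indicator of the failure of [A]. *)
Lemma gnp_prob_markov (R : realType) (n : nat) (p : R) (A : {set {set 'I_n}} -> Prop)
    (f : {set {set 'I_n}} -> R) :
  0 <= p <= 1 -> (forall E, 0 <= f E) ->
  (forall E : {set {set 'I_n}}, E \subset vpairs 'I_n -> ~ A E -> 1 <= f E) ->
  1 - gnp_mean p f <= gnp_prob p A.
Proof.
move=> p01 f0 fA; rewrite lerBlDr -[leLHS](@gnp_mean1 R n p).
rewrite /gnp_prob big_mkcondr /= -big_split /=.
apply: ler_sum => E EP; rewrite mulr1; have w0 := gnp_weight_ge0 E p01.
case: asboolP => [_|/(fA E EP) f1]; first by rewrite lerDl mulr_ge0.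
by rewrite add0r ler_peMr.
Qed.

(** * Edge cuts, failure events and the union bound *)

Definition edge_cut (V : finType) (S T : {set V}) : {set {set V}} :=
  [set [set ab.1; ab.2]%SET | ab in finset.setX S T]%SET.

Lemma edge_cut_vpairs (V : finType) (S T : {set V}) :
  {in S, forall z, z \notin T} -> edge_cut S T \subset vpairs V.
Proof.
move=> ST; apply/fintype.subsetP => _ /imsetP[[a b] /finset.setXP[/= aS bT] ->].
rewrite inE cards2; have [ab|//] := eqVneq a b.
by move: (ST a aS); rewrite ab bT.
Qed.

Lemma card_edge_cut (V : finType) (S T : {set V}) :
  {in S, forall z, z \notin T} -> #|edge_cut S T| = (#|S| * #|T|)%N.
Proof.
move=> ST; rewrite -cardsX card_in_imset //.
move=> [a b] [c d] /finset.setXP[/= aS bT] /finset.setXP[/= cS dT] eE.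
have ad : a != d by apply: contraTneq dT => <-; exact: ST.
have bc : b != c by apply: contraTneq bT => ->; exact: ST.
have : a \in [set c; d]%SET by rewrite -eE !inE eqxx.
have : b \in [set c; d]%SET by rewrite -eE !inE eqxx orbT.
rewrite !inE (negbTE ad) (negbTE bc) orbF /= => /eqP -> /eqP ->.
by [].
Qed.

Lemma not_spread_cases (V : finType) (E : {set {set V}}) (K : nat) :
  ~ spread E K ->
  [\/ exists v, forall u, ~~ adj E v u,
      exists a b, [/\ a != b, (#|nbrs E a| <= K)%N, (#|nbrs E b| <= K)%N & adj E a b],
      exists a b c, [/\ a != b, (#|nbrs E a| <= K)%N, (#|nbrs E b| <= K)%N &
        adj E a c && adj E b c]
    | exists w (S : {set V}), [/\ w \notin S, (K <= #|S|)%N, (2 * #|S| <= #|V|)%N &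
        forall a b, a \in S -> b \notin S -> b != w -> ~~ adj E a b]].
Proof.
move=> nsp; apply: contrapT => h; apply: nsp; split.
- move=> v; apply: contrapT => nu; apply: h; constructor 1; exists v => u.
  by apply/negP => vu; apply: nu; exists u.
- move=> a b ab aK bK; split=> [|c]; apply/negP => hadj; apply: h.
    by constructor 2; exists a, b.
  by constructor 3; exists a, b, c.
move=> w S wS SK S2; apply: contrapT => nab; apply: h; constructor 4; exists w, S.
split=> // a b aS bS bw; apply/negP => ab; apply: nab.
by exists a, b.
Qed.

Lemma sum_ge1 (R : realType) (I : finType) (P : pred I) (f : I -> R) i :
  (forall j, 0 <= f j) -> P i -> 1 <= f i -> 1 <= \sum_(j | P j) f j.
Proof.
move=> f0 Pi f1; rewrite (bigD1 i) //=; apply: le_trans f1 _.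
by rewrite lerDl sumr_ge0.
Qed.

(** Each counted edge joins [a] or [b] to one of its neighbours, whatever [F] removes. *)
Lemma low_degree_cut (V : finType) (E F : {set {set V}}) (a b : V) (K : nat) :
  (#|nbrs E a| <= K)%N -> (#|nbrs E b| <= K)%N ->
  (#|(edge_cut [set a; b] (~: [set a; b]) :\: F) :&: E| <= 2 * K)%N.
Proof.
move=> aK bK; apply: (@leq_trans (#|nbrs E a| + #|nbrs E b|)); last by lia.
apply: leq_trans (leq_add (leq_imset_card (fun z => [set a; z]%SET) _)
                          (leq_imset_card (fun z => [set b; z]%SET) _)).
apply: leq_trans (leq_card_setU _ _); apply/subset_leq_card/fintype.subsetP.
move=> e /finset.setIP[/finset.setDP[/imsetP[[u v] /finset.setXP[/= uab _] ->] _] uvE].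
case/finset.set2P: uab uvE => -> uvE; apply/finset.setUP; [left|right];
  by apply/imsetP; exists v; rewrite ?inE.
Qed.

(* The factor [t ^+ #|... :&: E|] with [t < 1] is an exponential Chernoff bound for
   the event that [a] and [b] have degree at most [K]. *)
Definition close_pair_term (R : realType) (n : nat) (t : R) (F : {set {set 'I_n}})
    (a b : 'I_n) (E : {set {set 'I_n}}) : R :=
  (F \subset E)%:R *
  t ^+ #|(edge_cut [set a; b] (~: [set a; b]) :\: F) :&: E|.

Lemma close_pair_term_ge1 (R : realType) (n K : nat) (t : R) (F : {set {set 'I_n}})
    (a b : 'I_n) (E : {set {set 'I_n}}) :
  0 < t <= 1 -> F \subset E -> (#|nbrs E a| <= K)%N -> (#|nbrs E b| <= K)%N ->
  1 <= t ^- (2 * K) * close_pair_term t F a b E.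
Proof.
move=> /andP[t0 t1] FE aK bK; rewrite /close_pair_term FE mul1r mulrC.
rewrite ler_pdivlMr ?exprn_gt0 // mul1r; apply: ler_wiXn2l (ltW t0) t1 _ _ _.
exact: low_degree_cut.
Qed.

Lemma close_pair_mean (R : realType) (n : nat) (p t : R) (F : {set {set 'I_n}})
    (a b : 'I_n) :
  0 <= p <= 1 -> 0 < t <= 1 -> a != b -> F \subset vpairs 'I_n -> (#|F| <= 2)%N ->
  gnp_mean p (close_pair_term t F a b) <=
  p ^+ #|F| * (1 - p + p * t) ^+ (2 * n - 6).
Proof.
move=> /andP[p0 p1] /andP[t0 t1] ab FP F2.
have cut0 : {in [set a; b]%SET, forall z, z \notin ~: [set a; b]%SET}.
  by move=> z zab; rewrite finset.in_setC negbK.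
have cutP := edge_cut_vpairs cut0.
rewrite /close_pair_term gnp_mean_tilt //.
- apply: ler_wpM2l; first exact: exprn_ge0.
  have pt : 0 <= p * t by rewrite mulr_ge0 // ltW.
  apply: ler_wiXn2l.
  + lra.
  + by nra.
  (* The cut has [2 * (n - 2)] edges, at most two of them in [F], so at least [2 * n - 6] remain; a
     base in [0, 1] allows lowering the exponent to that. *)
  have := cardsID F (edge_cut [set a; b] (~: [set a; b])).
  have := subset_leq_card (finset.subsetIr (edge_cut [set a; b] (~: [set a; b])) F).
  rewrite (card_edge_cut cut0); have := cardsC [set a; b]%SET.
  rewrite cards2 ab card_ord => /= hn hF hcut.
  have arith m : (2 + m = n -> 2 * n - 6 <= 2 * m - 2)%N by lia.
  apply: leq_trans (arith _ hn) _.
  by rewrite -hcut leq_subLR leq_add2r (leq_trans hF).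
- by apply: fintype.subset_trans cutP; exact: finset.subsetDl.
- by move=> e eF; rewrite finset.in_setD eF.
Qed.

(** Markov's inequality applied to [f1 + f2 + f3 + f4], one sum per way of failing [spread]: an
    isolated vertex, two adjacent small vertices, two small vertices with a common neighbour, a set
    whose outside neighbours are at most [w]. *)
Lemma gnp_cfc_le2_union_bound (R : realType) (n K : nat) (p t : R) :
  (0 < K)%N -> (0 < n)%N -> 0 <= p <= 1 -> 0 < t <= 1 ->
  1 - (n%:R * (1 - p) ^+ n.-1
       + t ^- (2 * K) * (n%:R ^+ 2 * p + n%:R ^+ 3 * p ^+ 2) *
           (1 - p + p * t) ^+ (2 * n - 6)
       + n%:R * \sum_(S : {set 'I_n} | (K <= #|S|)%N && (2 * #|S| <= n)%N)
                  (1 - p) ^+ (#|S| * (n.-1 - #|S|)))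
  <= gnp_prob p (@cfc_le 'I_n 2).
Proof.
move=> K0 n0 p01 t01; have /andP[p0 p1] := p01; have /andP[t0 t1] := t01.
pose P1 (a b : 'I_n) : {set {set 'I_n}} := [set [set a; b]]%SET.
pose P2 (a b c : 'I_n) : {set {set 'I_n}} := [set [set a; c]; [set b; c]]%SET.
(* An indicator written as a power of 0, with [0 ^+ 0 = 1], so that [gnp_mean_tilt] applies with
   [t = 0]. *)
pose no_edge (S T : {set 'I_n}) (E : {set {set 'I_n}}) : R :=
  (finset.set0 \subset E)%:R * 0 ^+ #|edge_cut S T :&: E|.
pose f1 E : R := \sum_(v : 'I_n) no_edge [set v]%SET (~: [set v]) E.
pose f2 E : R := \sum_(ab : 'I_n * 'I_n | ab.1 != ab.2)
  t ^- (2 * K) * close_pair_term t (P1 ab.1 ab.2) ab.1 ab.2 E.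
pose f3 E : R := \sum_(abc : 'I_n * 'I_n * 'I_n |
    [&& abc.1.1 != abc.1.2, abc.1.1 != abc.2 & abc.1.2 != abc.2])
  t ^- (2 * K) * close_pair_term t (P2 abc.1.1 abc.1.2 abc.2) abc.1.1 abc.1.2 E.
pose f4 E : R := \sum_(w : 'I_n) \sum_(S : {set 'I_n} |
    [&& w \notin S, (K <= #|S|)%N & (2 * #|S| <= n)%N])
  no_edge S (~: (w |: S)) E.
have tK0 : 0 <= t ^- (2 * K) by rewrite invr_ge0 exprn_ge0 // ltW.
have no_edge_ge0 S T E : 0 <= no_edge S T E.
  by rewrite mulr_ge0 ?ler0n ?exprn_ge0.
have close_ge0 F a b E : 0 <= t ^- (2 * K) * close_pair_term t F a b E.
  by rewrite mulr_ge0 // /close_pair_term mulr_ge0 ?ler0n ?exprn_ge0 // ltW.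
have f10 E : 0 <= f1 E by apply: sumr_ge0.
have f20 E : 0 <= f2 E by apply: sumr_ge0.
have f30 E : 0 <= f3 E by apply: sumr_ge0.
have f40 E : 0 <= f4 E by apply: sumr_ge0 => w _; apply: sumr_ge0.
have no_edge1 (S T : {set 'I_n}) E :
    (forall a b, a \in S -> b \in T -> ~~ adj E a b) -> 1 <= no_edge S T E.
  move=> nST; rewrite /no_edge finset.sub0set mul1r.
  rewrite (_ : _ :&: _ = finset.set0) ?cards0 ?expr0 //.
  apply/setP => e; rewrite finset.in_setI finset.in_set0; apply/negP.
  by move=> /andP[/imsetP[[a b] /finset.setXP[/= aS bT] ->]]; apply/negP/nST.
have no_edge_mean (S T : {set 'I_n}) : {in S, forall z, z \notin T} ->
    gnp_mean p (no_edge S T) = (1 - p) ^+ (#|S| * #|T|).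
  move=> ST; rewrite /no_edge gnp_mean_tilt ?finset.sub0set ?edge_cut_vpairs //.
    by rewrite cards0 expr0 mul1r mulr0 addr0 card_edge_cut.
  by move=> e; rewrite finset.in_set0.
pose x := 1 - p + p * t.
have x0 : 0 <= x by rewrite /x; nra.
have x1 : 0 <= x ^+ (2 * n - 6) by exact: exprn_ge0.
have m1 : gnp_mean p f1 = n%:R * (1 - p) ^+ n.-1.
  rewrite gnp_mean_sum (eq_bigr (fun=> (1 - p) ^+ n.-1)) => [|v _].
    by rewrite sumr_const card_ord mulr_natl.
  rewrite no_edge_mean; last by move=> z; rewrite finset.in_setC => ->.
  by rewrite cards1 mul1n cardsC1 card_ord.
have m2 : gnp_mean p f2 <= n%:R ^+ 2 * (t ^- (2 * K) * (p * x ^+ (2 * n - 6))).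
  rewrite gnp_mean_sum; apply: (@le_trans _ _
    (\sum_(ab : 'I_n * 'I_n) t ^- (2 * K) * (p * x ^+ (2 * n - 6)))); last first.
    by rewrite sumr_const card_prod card_ord -[leLHS]mulr_natl natrM -expr2.
  rewrite big_mkcond; apply: ler_sum => -[a b] _ /=; case: ifP => [ab|_].
    rewrite gnp_meanZ ler_wpM2l //.
    apply: le_trans (close_pair_mean p01 t01 ab _ _) _; rewrite ?cards1 ?expr1 //.
    by rewrite finset.sub1set inE cards2 ab.
  by rewrite !mulr_ge0.
have m3 : gnp_mean p f3 <= n%:R ^+ 3 * (t ^- (2 * K) * (p ^+ 2 * x ^+ (2 * n - 6))).
  rewrite gnp_mean_sum; apply: (@le_trans _ _
    (\sum_(ab : 'I_n * 'I_n * 'I_n) t ^- (2 * K) * (p ^+ 2 * x ^+ (2 * n - 6))));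
    last first.
    rewrite sumr_const !card_prod card_ord -[leLHS]mulr_natl !natrM.
    by rewrite (exprS _ 2) (expr2 n%:R) !mulrA.
  rewrite big_mkcond; apply: ler_sum => -[[a b] c] _ /=.
  case: ifP => [/and3P[ab ac bc]|_]; last by rewrite !mulr_ge0 ?exprn_ge0.
  rewrite gnp_meanZ ler_wpM2l //.
  have c2 : #|P2 a b c| = 2%N.
    rewrite cards2; suff -> : [set a; c]%SET != [set b; c]%SET by [].
    apply/eqP => /setP/(_ a); rewrite !inE eqxx (negbTE ac) (negbTE ab).
    by [].
  apply: le_trans (close_pair_mean p01 t01 ab _ _) _; rewrite ?c2 //.
  by rewrite finset.subUset !finset.sub1set !inE !cards2 ac bc.
have m4 : gnp_mean p f4 <= n%:R *
    \sum_(S : {set 'I_n} | (K <= #|S|)%N && (2 * #|S| <= n)%N)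
      (1 - p) ^+ (#|S| * (n.-1 - #|S|)).
  rewrite gnp_mean_sum mulr_natl -[X in _ *+ X]card_ord -sumr_const.
  apply: ler_sum => w _; rewrite gnp_mean_sum big_mkcondl /=; apply: ler_sum => S _.
  case: ifP => wS; last by rewrite exprn_ge0 // subr_ge0.
  rewrite no_edge_mean; last first.
    by move=> z zS; rewrite finset.in_setC finset.in_setU1 zS orbT.
  rewrite (_ : #|~: _| = n.-1 - #|S|)%N //.
  have arith k m : (1 + k + m = n -> m = n.-1 - k)%N by lia.
  by apply: arith; rewrite -[RHS]card_ord -(cardsC (w |: S)) cardsU1 wS.
apply: le_trans (gnp_prob_markov (f := fun E => f1 E + (f2 E + (f3 E + f4 E))) p01 _ _).
- rewrite -/x !gnp_meanD m1 lerD2l lerN2 -!addrA lerD2l.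
  apply: le_trans (lerD m2 (lerD m3 m4)) _.
  move: (t ^- _) (x ^+ _) (\sum_(_ | _) _) => tK xn s.
  by rewrite le_eqVlt; apply/orP; left; apply/eqP; ring.
- by move=> E; rewrite !addr_ge0.
move=> E EP ncfc; have sum4 (r1 r2 r3 r4 : R) : 0 <= r1 -> 0 <= r2 -> 0 <= r3 ->
    0 <= r4 -> [\/ 1 <= r1, 1 <= r2, 1 <= r3 | 1 <= r4] -> 1 <= r1 + (r2 + (r3 + r4)).
  by move=> ? ? ? ? [] ?; lra.
apply: sum4 => //; have nsp : ~ spread E K.
  by move=> sp; apply: ncfc; apply: (spread_cfc_le2 _ K0 EP sp); rewrite card_ord.
case: (not_spread_cases nsp) => [[v nv]|[a [b [ab aK bK hab]]]
  |[a [b [c [ab aK bK /andP[ac bc]]]]]|[w [S [wS SK S2 nS]]]].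
- constructor 1; apply: (sum_ge1 (i := v)) => //.
  by apply: no_edge1 => a b; rewrite finset.in_set1 => /eqP -> _; exact: nv.
- constructor 2; apply: (sum_ge1 (i := (a, b))) => //=.
  by apply: close_pair_term_ge1; rewrite // finset.sub1set.
- constructor 3; apply: (sum_ge1 (i := (a, b, c))) => //=.
    by rewrite ab (adj_neq EP ac) (adj_neq EP bc).
  apply: close_pair_term_ge1 => //; rewrite finset.subUset !finset.sub1set.
  by apply/andP.
constructor 4; apply: (sum_ge1 (i := w)) => // [j|]; first exact: sumr_ge0.
apply: (sum_ge1 (i := S)) => //; first by rewrite wS SK -[X in (_ <= X)%N](card_ord n).
apply: no_edge1 => a b aS; rewrite finset.in_setC finset.in_setU1 negb_or.
by move=> /andP[bw bS]; exact: nS.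
Qed.

(** * Asymptotics *)

Lemma onem_exp_le (R : realType) (p : R) (m : nat) :
  p <= 1 -> (1 - p) ^+ m <= expR (- (p * m%:R)).
Proof.
move=> p1; rewrite -mulNr expRM_natr; apply: lerXn2r.
- by rewrite nnegrE subr_ge0.
- by rewrite nnegrE expR_ge0.
exact: expR_ge1Dx.
Qed.

(** The exponent is [ln n - p * (n - 1)]; since [p <= 1], the lost [p] costs at most the constant
    1. *)
Lemma isolated_term_le (R : realType) (n : nat) (p a : R) :
  (0 < n)%N -> p <= 1 -> ln n%:R + a <= n%:R * p ->
  n%:R * (1 - p) ^+ n.-1 <= expR (1 - a).
Proof.
move=> n0 p1 hp; have N0 : 0 < n%:R :> R by rewrite ltr0n.
rewrite -[X in X * _](@lnK R) ?posrE //.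
apply: le_trans (ler_wpM2l (expR_ge0 _) (onem_exp_le _ p1)) _.
rewrite -expRD ler_expR -subn1 natrB //; lra.
Qed.

(** With [L = ln n] and [y = n * p], the three factors contribute the exponents [L / 4], [L + y / 8]
    and [- (3 / 2) * y + 9 / 2]. As [y >= L], their sum is at most [- L / 8 + 9 / 2]. *)
Lemma close_pair_terms_le (R : realType) (n K : nat) (p : R) :
  (3 <= n)%N -> 0 <= p <= 1 -> 16 * K%:R <= ln (n%:R : R) ->
  ln n%:R <= n%:R * p -> 0 <= ln (n%:R : R) ->
  expR (- 2) ^- (2 * K) * (n%:R ^+ 2 * p + n%:R ^+ 3 * p ^+ 2) *
    (1 - p + p * expR (- 2)) ^+ (2 * n - 6)
  <= 256 * expR (9 / 2) * expR (- ln n%:R / 8).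
Proof.
move=> n3 /andP[p0 p1] KL hp L0.
have N0 : 0 < n%:R :> R by rewrite ltr0n; lia.
set L := ln n%:R in KL hp L0 *; set N : R := n%:R in hp N0 *; set y := N * p in hp.
have NE : N = expR L by rewrite lnK.
have y0 : 0 <= y by rewrite mulr_ge0 // ltW.
have tE : expR (- 2) ^- (2 * K) = expR (4 * K%:R) :> R.
  by rewrite -expRM_natr -expRN natrM; congr expR; ring.
have t4 : expR (- 2) <= 1 / 4 :> R.
  have e1 : 2 <= expR 1 :> R by apply: le_trans (expR_ge1Dx 1); lra.
  have e2 : 4 <= expR 2 :> R.
    by rewrite (_ : 2 = 1 + 1 :> R) ?expRD; [nra|ring].
  by rewrite expRN -[leRHS]invrK lef_pV2 ?posrE ?expR_gt0 // invf_div; lra.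
have t0 := expR_ge0 (- 2 : R).
have xle : (1 - p + p * expR (- 2)) ^+ (2 * n - 6) <= expR (- (3 / 2) * y + 9 / 2).
  apply: (@le_trans _ _ ((1 - 3 / 4 * p) ^+ (2 * n - 6))).
    by apply: lerXn2r; rewrite ?nnegrE; nra.
  apply: le_trans (onem_exp_le _ _) _; first by lra.
  rewrite ler_expR natrB ?natrM; last by lia.
  rewrite -/N /y; nra.
(* The constant 256 comes from [y + y ^+ 2 <= (16 + y) ^+ 2 = 256 * (1 + y / 16) ^+ 2]. *)
have polyle : N ^+ 2 * p + N ^+ 3 * p ^+ 2 <= 256 * expR (L + y / 8).
  rewrite expRD -NE (_ : N ^+ 2 * p + _ = N * (y + y ^+ 2)); last by rewrite /y; ring.
  rewrite mulrCA ler_pM2l // (_ : y / 8 = y / 16 + y / 16); last by lra.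
  rewrite expRD; have := expR_ge1Dx (y / 16); set E := expR _; nra.
rewrite tE; apply: (@le_trans _ _
   (expR (L / 4) * (256 * expR (L + y / 8)) * expR (- (3 / 2) * y + 9 / 2))).
  apply: ler_pM => //.
  - rewrite mulr_ge0 ?expR_ge0 // addr_ge0 // mulr_ge0 ?exprn_ge0 // ltW //.
  - by rewrite exprn_ge0 //; nra.
  apply: ler_pM => //; rewrite ?expR_ge0 //.
  - by rewrite addr_ge0 // mulr_ge0 ?exprn_ge0 // ltW.
  - by rewrite ler_expR; lra.
clearbody y; rewrite [_ * (256 * _)]mulrCA -!mulrA -!expRD ler_pM2l ?ler_expR //; lra.
Qed.

Lemma sum_expr_card (R : realType) (T : finType) (z : R) :
  \sum_(S : {set T}) z ^+ #|S| = (1 + z) ^+ #|T|.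
Proof.
rewrite -(prodr_const (mem T)) addrC.
rewrite (@bigA_distr _ _ _ _ _ T (fun=> z) (fun=> 1)).
apply: eq_bigr => S _; rewrite -prodr_const big_mkcond /=.
by [].
Qed.

(* Write [k = #|S|], [N = n] and [L = ln n].  If [k * L <= 6 * N] the term of [S] is
   at most [expR (7 - L) ^+ k], and the weight [expR (48 * (k - K)) >= 1] turns the
   sum over [#|S| >= K] into the binomial expansion over all [S]; otherwise the term
   is at most [expR (- (2 * N))], which beats the number [2 ^ n] of sets. *)
Lemma cut_terms_le (R : realType) (n K : nat) (p : R) :
  (6 <= n)%N -> 0 <= p <= 1 -> ln (n%:R : R) < 16 * (K%:R + 1) ->
  ln n%:R <= n%:R * p -> 1 <= ln (n%:R : R) ->
  n%:R * \sum_(S : {set 'I_n} | (K <= #|S|)%N && (2 * #|S| <= n)%N)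
            (1 - p) ^+ (#|S| * (n.-1 - #|S|))
  <= (expR (48 + expR 55) + 1) * expR (- ln n%:R / 8).
Proof.
move=> n6 /andP[p0 p1] KL hp L1.
have N0 : 0 < n%:R :> R by rewrite ltr0n; lia.
have N6 : 6 <= n%:R :> R by rewrite (ler_nat _ 6).
set L := ln n%:R in KL hp L1 *; set N : R := n%:R in hp N0 N6 *.
have NE : N = expR L by rewrite lnK.
have LN : L <= N by rewrite NE; apply: le_trans (expR_ge1Dx L); lra.
have bound (k : nat) : (2 * k <= n)%N ->
    (1 - p) ^+ (k * (n.-1 - k)) <= expR (7 - L) ^+ k + expR (- (2 * N)).
  move=> kn; set m := (n.-1 - k)%N.
  have mE : m%:R = N - 1 - k%:R :> R.
    by rewrite /m -subn1 !natrB //; lia.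
  have kN : 2 * k%:R <= N by rewrite -natrM ler_nat.
  have k0 : 0 <= k%:R :> R by [].
  have pmN : L * m%:R <= N * (p * m%:R) by rewrite mulrA ler_wpM2r.
  (* When [k * L <= 6 * N], also [L <= N] gives [L * m >= N * (L - 7)], hence [p * m >= L - 7].
     Otherwise [m >= N / 3], valid as [N >= 6], gives [k * L * m >= 2 * N ^+ 2]. *)
  have [kL|kL] := lerP (k%:R * L) (6 * N).
    apply: (@le_trans _ _ (expR (7 - L) ^+ k)); last by rewrite lerDl expR_ge0.
    rewrite mulnC exprM; apply: lerXn2r;
      rewrite ?nnegrE ?exprn_ge0 ?subr_ge0 ?expR_ge0 //.
    apply: le_trans (onem_exp_le _ p1) _; rewrite ler_expR.
    rewrite -(ler_pM2l N0); rewrite mE in pmN *; nra.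
  apply: (@le_trans _ _ (expR (- (2 * N)))); last first.
    by rewrite lerDr exprn_ge0 // expR_ge0.
  apply: le_trans (onem_exp_le _ p1) _; rewrite ler_expR lerN2 natrM.
  have mN : N / 3 <= m%:R by rewrite mE; lra.
  rewrite -(ler_pM2l N0); apply: (@le_trans _ _ (k%:R * L * m%:R)).
    by nra.
  by have := ler_wpM2l k0 pmN; lra.
(* From [L < 16 * (K + 1)], the factor [expR (- (48 * K))] is at most [expR (48 - 3 * L)]. As
   [N = expR L], the binomial sum [(1 + expR (55 - L)) ^+ n] is at most [expR (expR 55)]. *)
have sum1 : \sum_(S : {set 'I_n} | (K <= #|S|)%N && (2 * #|S| <= n)%N)
      (1 - p) ^+ (#|S| * (n.-1 - #|S|)) <=
    expR (48 - 3 * L) * expR (expR 55) + expR (- N).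
  apply: (@le_trans _ _ (\sum_(S : {set 'I_n})
      (expR (- (48 * K%:R)) * (expR (55 - L)) ^+ #|S| + expR (- (2 * N))))).
    rewrite big_mkcond; apply: ler_sum => S _; case: ifP => [/andP[KS Sn]|_]; last first.
      by rewrite addr_ge0 ?mulr_ge0 ?exprn_ge0 ?expR_ge0.
    apply: le_trans (bound _ Sn) _; rewrite lerD2r -!expRM_natr -expRD ler_expR.
    have : K%:R <= #|S|%:R :> R by rewrite ler_nat.
    lra.
  rewrite big_split /= -mulr_sumr sum_expr_card sumr_const.
  rewrite -(cardsT {set 'I_n}) -powersetT card_powerset cardsT card_ord.
  apply: lerD.
    apply: ler_pM; rewrite ?expR_ge0 ?exprn_ge0 ?addr_ge0 ?expR_ge0 //.
      by rewrite ler_expR; lra.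
    apply: le_trans (lerXn2r n _ _ (expR_ge1Dx (expR (55 - L)))) _;
      rewrite ?nnegrE ?addr_ge0 ?expR_ge0 //.
    by rewrite -expRM_natr ler_expR -/N [X in _ * X]NE -expRD subrK.
  rewrite -[leLHS]mulr_natl natrX.
  have e2 : 2 ^+ n <= expR N.
    rewrite -[N]mul1r expRM_natr; apply: lerXn2r; rewrite ?nnegrE ?expR_ge0 //.
    by apply: le_trans (expR_ge1Dx 1); lra.
  apply: le_trans (ler_wpM2r (expR_ge0 _) e2) _.
  by rewrite -expRD ler_expR; lra.
apply: le_trans (ler_wpM2l (ltW N0) sum1) _.
rewrite mulrDr [leRHS]mulrDl mul1r.
have -> : N * (expR (48 - 3 * L) * expR (expR 55)) =
    expR (L + (48 - 3 * L + expR 55)) by rewrite NE -!expRD.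
have -> : N * expR (- N) = expR (L - N) by rewrite [X in X * _]NE -expRD.
rewrite -expRD; apply: lerD; rewrite ler_expR; first by lra.
(* What remains is [N >= 9 / 8 * L], obtained by squaring this inequality. *)
have : 1 + L / 2 <= expR (L / 2) by exact: expR_ge1Dx.
have : N = expR (L / 2) * expR (L / 2) by rewrite -expRD NE; congr expR; lra.
set F := expR (L / 2); nra.
Qed.

Lemma gnp_cfc_le2_ge (R : realType) (n : nat) (p a : R) :
  0 <= p <= 1 -> 0 <= a -> 16 <= ln (n%:R : R) -> (ln n%:R + a) / n%:R <= p ->
  1 - (expR (1 - a)
       + (256 * expR (9 / 2) + expR (48 + expR 55) + 1) * expR (- ln n%:R / 8))
  <= gnp_prob p (@cfc_le 'I_n 2).
Proof.
move=> p01 a0 L16 hp; have /andP[p0 p1] := p01.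
have n0 : (0 < n)%N by case: n L16 {hp} => // ; rewrite ln0 //; lra.
have N0 : 0 < n%:R :> R by rewrite ltr0n.
have n6 : (6 <= n)%N.
  rewrite -(ler_nat R) -[leRHS](@lnK R) ?posrE //.
  by apply: le_trans (expR_ge1Dx _); lra.
move: hp; rewrite ler_pdivrMr // mulrC => hp.
have hpL : ln n%:R <= n%:R * p by lra.
(* The integer part of [ln n / 16]: its upper bound feeds the estimate for close pairs, its lower
   bound the one for cuts, and [ln n >= 16] makes it positive. *)
pose K := Num.truncn (ln (n%:R : R) / 16).
have /andP[KL LK] : K%:R <= ln (n%:R : R) / 16 < K.+1%:R.
  by apply: truncn_itv; lra.
rewrite -(natr1 K) in LK.
have K0 : (0 < K)%N by rewrite truncn_gt0; lra.
have t01 : 0 < expR (- 2 : R) <= 1 by rewrite expR_gt0 expR_le1; lra.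
apply: le_trans (gnp_cfc_le2_union_bound K0 n0 p01 t01).
rewrite lerD2l lerN2.
have b1 := isolated_term_le n0 p1 hp.
have L0 : 0 <= ln (n%:R : R) by lra.
have L1 : 1 <= ln (n%:R : R) by lra.
have KL' : 16 * K%:R <= ln (n%:R : R) by lra.
have LK' : ln (n%:R : R) < 16 * (K%:R + 1) by lra.
have b2 := close_pair_terms_le (leq_trans (isT : 3 <= 6)%N n6) p01 KL' hpL L0.
have b3 := cut_terms_le n6 p01 LK' hpL L1.
rewrite -[in leRHS]addrA [in leRHS]mulrDl addrA.
exact: lerD (lerD b1 b2) b3.
Qed.

Lemma cvg_ln_natr (R : realType) : (ln (n%:R : R)) @[n --> \oo] --> +oo.
Proof.
apply/cvgryPge => A; near=> n.
have hn : expR A <= n%:R by near: n; exact: nbhs_infty_ger.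
rewrite -ler_expR lnK // posrE; exact: lt_le_trans (expR_gt0 A) hn.
Unshelve. all: by end_near. Qed.

Theorem theorem1p9 (R : realType) (alpha p : nat -> R)
  (alpha_oo : alpha n @[n --> \oo] --> +oo%R)
  (p01 : forall n, 0 <= p n <= 1)
  (p_ge : \forall n \near \oo, (ln n%:R + alpha n) / n%:R <= p n) :
  gnp_prob (p n) (@cfc_le 'I_n 2) @[n --> \oo] --> (1 : R).
Proof.
pose C : R := 256 * expR (9 / 2) + expR (48 + expR 55) + 1.
pose lower n : R := 1 - (expR (1 - alpha n) + C * expR (- ln n%:R / 8)).
have expN_cvg (f : nat -> R) :
    f n @[n --> \oo] --> +oo -> expR (- f n) @[n --> \oo] --> (0 : R).
  by move=> fy; exact: (cvg_comp _ _ fy (@cvgr_expR R)).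
(* The finite bound applies once [alpha n >= 0] and [ln n >= 16]; both error terms in [lower] then
   tend to 0. *)
apply: (@squeeze_cvgr _ _ _ _ lower (fun=> 1)).
- near=> n; rewrite gnp_prob_le1 // andbT; apply: gnp_cfc_le2_ge => //.
  + by near: n; move/cvgryPge: alpha_oo; exact.
  + by near: n; move/cvgryPge: (@cvg_ln_natr R); exact.
  + by near: n.
- have iso : expR (1 - alpha n) @[n --> \oo] --> expR 1 * (0 : R).
    under eq_fun do rewrite expRD.
    by apply: cvgM; [exact: cvg_cst|exact: expN_cvg].
  have rest : expR (- ln (n%:R : R) / 8) @[n --> \oo] --> (0 : R).
    under eq_fun do rewrite mulNr.
    apply: expN_cvg; apply/cvgryPge => A.
    move/cvgryPge: (@cvg_ln_natr R) => /(_ (8 * A)); apply: filterS => n hn.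
    by rewrite ler_pdivlMr // mulrC.
  have := cvgB (cvg_cst (1 : R)) (cvgD iso (cvgM (cvg_cst C) rest)).
  by rewrite !mulr0 addr0 subr0; apply.
exact: cvg_cst.
Unshelve. all: by end_near. Qed.
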